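(* Let $\mathcal{L}$ be a distributed language restricted to paths, with a finite set $\Sigma$ of input values. If $\mathcal{L}\in B_1(O(1))$, then $\mathcal{L}\in \mathrm{LD}(O(1))$. That is, if for some constants $p,q\in(0,1]$ with $p^2+q>1$ the language $\mathcal{L}$ has a randomized $(p,q)$-decider whose running time is bounded by a constant, then $\mathcal{L}$ can be decided by a deterministic distributed algorithm whose running time is bounded by a constant.
   Context: Model ($\mathcal{LOCAL}$). The network is a connected graph $G$ on $n$ nodes. An identity assignment $\mathrm{Id}$ gives distinct integers to the nodes. All nodes start simultaneously, run the same algorithm, and proceed in fault-free synchronous rounds; in each round every node sends messages of unlimited size to its neighbors, receives the messages of its neighbors, and performs arbitrary local computations. Initially a node knows only its identity and its local input (in particular not $n$, nor its position in the graph). Each node eventually terminates and outputs ''yes'' or ''no''. In $t$ rounds, the output of a node depends only on the radius-$t$ neighborhood around it (structure, identities, inputs, and random bits if any). In a randomized algorithm, each node may in addition generate private, mutually independent random bits at any round. Languages. An instance is a pair $(G,\mathbf{x})$ where $G$ is a connected $n$-node graph and $\mathbf{x}\in\Sigma^n$ assigns to each node $v$ a local input $\mathbf{x}(v)\in\Sigma$; instances are regarded as input-labelled graphs, up to isomorphism. A distributed language is a decidable collection of instances. ''Restricted to paths'' means that the only instances considered (both those in $\mathcal{L}$ and those not in $\mathcal{L}$) are pairs $(P,\mathbf{x})$ with $P$ a path, so that the requirements on algorithms below are imposed for path instances only. Deciders. A deterministic algorithm decides $\mathcal{L}$ if for every instance and every identity assignment: all nodes output ''yes'' if the instance is in $\mathcal{L}$,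 and at least one node outputs ''no'' if it is not in $\mathcal{L}$. For constants $p,q\in(0,1]$, a randomized algorithm is a $(p,q)$-decider for $\mathcal{L}$ if for every instance and every identity assignment every node eventually terminates with output ''yes'' or ''no'', and: if the instance is in $\mathcal{L}$ then $\Pr[\text{all nodes output ''yes''}]\ge p$; if it is not in $\mathcal{L}$ then $\Pr[\text{at least one node outputs ''no''}]\ge q$. The running time is the maximum number of rounds until termination over all nodes (and all coin tosses). $\mathrm{LD}(O(1))$ is the class of languages decided by a deterministic algorithm with running time at most some constant (independent of instance and identities). $B_1(O(1))$ is the class of languages that, for some constants $p,q\in(0,1]$ with $p^2+q>1$, have a $(p,q)$-decider with running time at most some constant. *)

(* Defs.v *)
From HB Require Import structures.
From mathcomp Require Import all_boot all_order all_algebra.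
From mathcomp Require Import all_classical all_reals all_analysis.

Set Implicit Arguments.
Unset Strict Implicit.
Unset Printing Implicit Defensive.

Import Order.TTheory GRing.Theory Num.Theory.

Local Open Scope classical_set_scope.
Local Open Scope ring_scope.

Record instance (Sigma : Type) := Instance {
  nnodes : nat;
  edge : rel 'I_nnodes;
  input : 'I_nnodes -> Sigma;
  nnodes_gt0 : (0 < nnodes)%N;
  edge_sym : symmetric edge;
  edge_irr : irreflexive edge;
  edge_connected : forall u v, connect edge u v }.

Definition isomorphic (Sigma : Type) (I J : instance Sigma) : Prop :=
  exists f : 'I_(nnodes I) -> 'I_(nnodes J),
    [/\ bijective f,
        forall u v, edge (f u) (f v) = edge u v
      & forall u, input (f u) = input u].

(* The one-node graph counts as a path. *)
Definition is_path (Sigma : Type) (I : instance Sigma) : Prop :=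
  exists f : 'I_(nnodes I) -> 'I_(nnodes I),
    bijective f /\
    forall i j : 'I_(nnodes I),
      edge (f i) (f j) = (i.+1 == j :> nat) || (j.+1 == i :> nat).

(* Kleene's general recursive functions: minimisation is only applied to
   functions for which it is total.  A function of arity k is represented by a
   function of sequences reading the first k entries, missing ones being 0. *)
Inductive recursive : (seq nat -> nat) -> Prop :=
| rec_zero : recursive (fun=> 0%N)
| rec_succ : recursive (fun s => (head 0%N s).+1)
| rec_proj (i : nat) : recursive (fun s => nth 0%N s i)
| rec_comp (f : seq nat -> nat) (gs : seq (seq nat -> nat)) :
    recursive f ->
    (forall i, (i < size gs)%N -> recursive (nth (fun=> 0%N) gs i)) ->
    recursive (fun s => f [seq g s | g <- gs])
| rec_prim (f g : seq nat -> nat) :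
    recursive f -> recursive g ->
    recursive (fun s => iteri (head 0%N s)
                              (fun i r => g [:: i, r & behead s])
                              (f (behead s)))
| rec_min (f : seq nat -> nat) (f0 : forall s, exists i, f (i :: s) == 0%N) :
    recursive f -> recursive (fun s => ex_minn (f0 s)).

Definition code (Sigma : countType) (I : instance Sigma) : nat :=
  pickle (nnodes I,
          [seq edge u v | u <- enum 'I_(nnodes I), v <- enum 'I_(nnodes I)],
          [seq input u | u <- enum 'I_(nnodes I)]).

Definition language (Sigma : countType) (L : instance Sigma -> Prop) : Prop :=
  (forall I J, isomorphic I J -> L I -> L J) /\
  (exists f, recursive f /\ forall I, L I <-> f [:: code I] = 1%N).

(* A local computation that may toss coins adaptively; being inductive, it
   halts after finitely many tosses whatever their results.  Otherwise local
   computations are arbitrary functions. *)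
Inductive tossing (A : Type) : Type :=
| Ret of A
| Toss of (bool -> tossing A).

Fixpoint run (A : Type) (tape : nat -> bool) (c : tossing A) : A :=
  match c with
  | Ret a => a
  | Toss f => run (fun k => tape k.+1) (f (tape 0%N))
  end.

(* There is no port numbering: neighbours can only be told apart by their
   identities.  [send s i] is the message meant for the neighbour of identity
   [i], if there is one; the messages received are indexed by the identities of
   their senders.  Since [init] only gets the identity and the input of the
   node, a node does not even know its degree before the first round. *)
Record algorithm (Sigma : Type) := Algorithm {
  state : Type;
  message : Type;
  init : int -> Sigma -> tossing state;
  send : state -> int -> message;
  step : state -> (int -> option message) -> tossing state;
  verdict : state -> option bool (* [None] as long as the node is running *) }.

Definition deterministic (Sigma : Type) (A : algorithm Sigma) : Prop :=
  (forall i a, exists s, init A i a = Ret s) /\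
  (forall s m, exists s', @step _ A s m = Ret s').

(* Messages received by [v] when the nodes are in the states [st]; terminated
   nodes are silent. *)
Definition inbox (Sigma : Type) (A : algorithm Sigma) (I : instance Sigma)
    (id : 'I_(nnodes I) -> int) (st : 'I_(nnodes I) -> state A)
    (v : 'I_(nnodes I)) (i : int) : option (message A) :=
  omap (fun u => send (st u) (id v))
    [pick u | [&& edge v u, id u == i & verdict (st u) == None]].

(* States after [t] rounds, where [toss v r k] is the [k]-th coin tossed by [v]
   in round [r] ([r = 0] being the initialisation). *)
Fixpoint exec (Sigma : Type) (A : algorithm Sigma) (I : instance Sigma)
    (id : 'I_(nnodes I) -> int) (toss : 'I_(nnodes I) -> nat -> nat -> bool)
    (t : nat) : 'I_(nnodes I) -> state A :=
  match t with
  | 0%N => fun v => run (toss v 0%N) (init A (id v) (input v))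
  | t'.+1 => fun v =>
      let st := exec A id toss t' in
      if verdict (st v) is Some _ then st v
      else run (toss v t) (step (st v) (inbox id st v))
  end.

Definition outputs (Sigma : Type) (A : algorithm Sigma) (I : instance Sigma)
    (id : 'I_(nnodes I) -> int) (toss : 'I_(nnodes I) -> nat -> nat -> bool)
    (v : 'I_(nnodes I)) (b : bool) : Prop :=
  exists t, verdict (exec A id toss t v) = Some b.

(* From here on, [D] is the class of instances under consideration: nothing is
   required of the algorithms outside [D]. *)

Definition time_at_most (Sigma : Type) (D : instance Sigma -> Prop)
    (A : algorithm Sigma) (T : nat) : Prop :=
  forall (I : instance Sigma) (id : 'I_(nnodes I) -> int) toss v,
    D I -> injective id -> verdict (exec A id toss T v) <> None.

Definition decides (Sigma : Type) (D L : instance Sigma -> Prop)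
    (A : algorithm Sigma) : Prop :=
  forall (I : instance Sigma) (id : 'I_(nnodes I) -> int) toss,
    D I -> injective id ->
    (L I -> forall v, outputs A id toss v true) /\
    (~ L I -> exists v, outputs A id toss v false).

Definition in_LD_const (Sigma : Type) (D L : instance Sigma -> Prop) : Prop :=
  exists (A : algorithm Sigma) (T : nat),
    [/\ deterministic A, time_at_most D A T & decides D L A].

(* Mutually independent fair bits; [coin (v, r, k)] will be the [k]-th coin
   tossed by node [v] in round [r]. *)
Definition fair_coins (R : realType) (d : measure_display)
    (Omega : measurableType d) (P : probability Omega R)
    (coin : nat * nat * nat -> Omega -> bool) : Prop :=
  (forall i, measurable_fun setT (coin i)) /\
  (forall (s : seq (nat * nat * nat)) (b : nat * nat * nat -> bool), uniq s ->
     P [set w | forall i, i \in s -> coin i w = b i] = (2^-1 ^+ size s)%:E).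

Definition randomized_decider (R : realType) (d : measure_display)
    (Omega : measurableType d) (P : probability Omega R)
    (coin : nat * nat * nat -> Omega -> bool) (p q : R)
    (Sigma : Type) (D L : instance Sigma -> Prop) (A : algorithm Sigma) : Prop :=
  forall (I : instance Sigma) (id : 'I_(nnodes I) -> int),
    D I -> injective id ->
    let toss w (v : 'I_(nnodes I)) r k := coin (v : nat, r, k) w in
    (L I ->
       (p%:E <= P [set w | forall v, outputs A id (toss w) v true])%E) /\
    (~ L I ->
       (q%:E <= P [set w | exists v, outputs A id (toss w) v false])%E).

Definition in_B1_const (R : realType) (d : measure_display)
    (Omega : measurableType d) (P : probability Omega R)
    (coin : nat * nat * nat -> Omega -> bool)
    (Sigma : Type) (D L : instance Sigma -> Prop) : Prop :=
  exists p q : R,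
    [/\ 0 < p <= 1, 0 < q <= 1, 1 < p ^+ 2 + q
      & exists (A : algorithm Sigma) (T : nat),
          time_at_most D A T /\ randomized_decider P coin p q D L A].

(* Main.v *)
(* If [p ^ 2 + q > 1], two members of [L] can be glued along a long common
   segment.  In the first one, the identities being fixed, blocks of the segment
   that are far apart accept independently, so one of them accepts with
   probability close to 1, or the whole path would be accepted with probability
   less than [p].  Cutting both paths there and joining their outer parts gives a
   path whose two sides behave as in the original ones and are independent: it is
   accepted with probability greater than [1 - q], hence is in [L].
   Consequently a path all of whose bounded views occur in members of [L] is
   itself in [L], by extending a prefix one node at a time, and a deterministic
   algorithm can check the views. *)
Require Import Defs.
From HB Require Import structures.
From mathcomp Require Import all_boot all_order all_algebra.
From mathcomp Require Import all_classical all_reals all_analysis.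
From mathcomp Require Import zify lra.

Set Implicit Arguments.
Unset Strict Implicit.
Unset Printing Implicit Defensive.

Import Order.TTheory GRing.Theory Num.Theory.

Local Open Scope classical_set_scope.
Local Open Scope ring_scope.

(** * Executions: locality and finite use of coins *)

Fixpoint depth (A : Type) (c : tossing A) : nat :=
  match c with
  | Ret _ => 0%N
  | Toss f => (maxn (depth (f true)) (depth (f false))).+1
  end.

Lemma eq_run (A : Type) (c : tossing A) (tape tape' : nat -> bool) :
  (forall k, (k < depth c)%N -> tape k = tape' k) -> run tape c = run tape' c.
Proof.
elim: c tape tape' => //= f IH tape tape' eqt.
rewrite eqt //; apply: IH => k ltk; apply: eqt.
by rewrite ltnS (leq_trans ltk) //; case: (tape' 0%N); rewrite ?leq_maxl ?leq_maxr.
Qed.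

Section Execution.
Variables (Sigma : Type) (A : algorithm Sigma).

(** [M t u v] is meant to say that the balls of radius [t] around [u] and [v] look alike, so
    neighbours only have to be matched with one round less to go. As identities are distinct, the
    sender that [inbox] picks for an identity is the matched neighbour. *)
Lemma exec_bisim (I J : instance Sigma) idI idJ tossI tossJ
    (M : nat -> 'I_(nnodes I) -> 'I_(nnodes J) -> Prop) :
  injective idI -> injective idJ ->
  (forall t u v, M t u v ->
     [/\ idI u = idJ v, input u = input v & tossI u =2 tossJ v]) ->
  (forall t u v, M t.+1 u v -> M t u v) ->
  (forall t u v u', M t.+1 u v -> edge u u' -> exists2 v', edge v v' & M t u' v') ->
  (forall t u v v', M t.+1 u v -> edge v v' -> exists2 u', edge u u' & M t u' v') ->
  forall t u v, M t u v -> exec A idI tossI t u = exec A idJ tossJ t v.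
Proof.
move=> injI injJ data mono forth back; elim=> [|t IH] u v Muv /=.
  by have [-> -> eqt] := data _ _ _ Muv; apply: eq_run => k _; exact: eqt.
have [eqid _ eqt] := data _ _ _ Muv.
rewrite (IH _ _ (mono _ _ _ Muv)); case: verdict => // .
suff -> : inbox idI (exec A idI tossI t) u = inbox idJ (exec A idJ tossJ t) v.
  by apply: eq_run => k _; rewrite eqt.
apply/funext => i; rewrite /inbox.
case: pickP => [u' /and3P[uu' /eqP idu' vu'] | nou].
  have [v' vv' Muv'] := forth _ _ _ _ Muv uu'.
  have [eqid' _ _] := data _ _ _ Muv'.
  rewrite /= (IH _ _ Muv') in vu' *.
  case: pickP => [v'' /and3P[_ /eqP idv'' _] | /(_ v')] /=.
    suff -> : v'' = v' by rewrite eqid.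
    by apply: injJ; rewrite idv'' -eqid'.
  by rewrite vv' -eqid' idu' eqxx vu'.
case: pickP => //= v' /and3P[vv' /eqP idv' vv0].
have [u' uu' Muv'] := back _ _ _ _ Muv vv'.
have [eqid' _ _] := data _ _ _ Muv'.
by have := nou u'; rewrite uu' eqid' idv' eqxx (IH _ _ Muv') vv0.
Qed.

(** Coins are tossed adaptively, without an a priori bound. Still, finitely many coins lead to
    finitely many states, from which the next round can only toss boundedly many more. Hence every
    event about a bounded execution is a finite combination of cylinders. *)
Lemma exec_finite (I : instance Sigma) (id : 'I_(nnodes I) -> int) (t : nat) :
  exists K, forall toss toss' : 'I_(nnodes I) -> nat -> nat -> bool,
    (forall v r k, (r <= t)%N -> (k < K)%N -> toss v r k = toss' v r k) ->
    exec A id toss t = exec A id toss' t.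
Proof.
elim: t => [|t [K IH]] /=.
  exists (\max_v depth (init A (id v) (input v))) => toss toss' eqt.
  apply/funext => v; apply: eq_run => k ltk; apply: eqt => //.
  exact: leq_trans ltk (leq_bigmax v).
(* The tables [h] of coins relevant to the first [t] rounds form a finite type, over which the
   number of tosses of the next round can be maximised. *)
pose X := ('I_(nnodes I) * 'I_t.+1 * 'I_K)%type.
pose ext (h : {ffun X -> bool}) (v : 'I_(nnodes I)) r k :=
  if insub r is Some r' then if insub k is Some k' then h (v, r', k') else false
  else false.
pose st h := exec A id (ext h) t.
pose K' := \max_(h : {ffun X -> bool}) \max_v
  depth (step (st h v) (inbox id (st h) v)).
exists (maxn K K') => toss toss' eqt.
pose h := [ffun x : X => toss x.1.1 x.1.2 x.2].
have eqst : exec A id toss t = st h.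
  apply: IH => v r k ltr ltk; rewrite /ext.
  by rewrite (insubT (fun x => x < t.+1)%N ltr) (insubT (fun x => x < K)%N ltk) ffunE.
have <- : exec A id toss t = exec A id toss' t.
  apply: IH => v r k ltr ltk; apply: eqt; first exact: leqW.
  by rewrite leq_max ltk.
rewrite eqst; apply/funext => v; case: verdict => //.
apply: eq_run => k ltk; apply: eqt => //; rewrite leq_max; apply/orP; right.
apply: (leq_trans ltk); apply: leq_trans (leq_bigmax h).
exact: (leq_bigmax (F := fun v => depth (step (st h v) (inbox id (st h) v)))).
Qed.

Lemma exec_verdict (I : instance Sigma) (id : 'I_(nnodes I) -> int) toss v t T b :
  (t <= T)%N -> verdict (exec A id toss t v) = Some b ->
  verdict (exec A id toss T v) = Some b.
Proof.
move=> /subnKC <-; elim: (T - t)%N => [|d IH] Hb; first by rewrite addn0.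
by rewrite addnS /= (IH Hb) (IH Hb).
Qed.

Lemma outputsE (D : instance Sigma -> Prop) T (I : instance Sigma)
    (id : 'I_(nnodes I) -> int) toss v b :
  time_at_most D A T -> D I -> injective id ->
  outputs A id toss v b <-> verdict (exec A id toss T v) = Some b.
Proof.
move=> timeT DI injid; split=> [[t Ht] | Ht]; last by exists T.
have [leT | /ltnW leT] := leqP t T; first exact: exec_verdict leT Ht.
case E : (verdict (exec A id toss T v)) => [b'|].
  by rewrite -Ht (exec_verdict leT E).
by have := timeT I id toss v DI injid E.
Qed.

End Execution.

(** * Probability of events that depend on finitely many coins *)

Section Coins.
Variables (R : realType) (d : measure_display) (Omega : measurableType d).
Variables (P : probability Omega R) (coin : nat * nat * nat -> Omega -> bool).
Hypothesis coin_fair : fair_coins P coin.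

Local Notation index := (nat * nat * nat)%type.
Local Notation event := ((index -> bool) -> Prop).

(** Events are predicates on coin tapes rather than subsets of [Omega], so that the coins they
    depend on can be named. *)
Definition Pr (E : event) : R := fine (P [set w | E (coin^~ w)]).

Definition depends (S : {pred index}) (E : event) : Prop :=
  forall tau tau', {in S, tau =1 tau'} -> E tau -> E tau'.

Definition finitary (E : event) : Prop := exists s : seq index, depends (mem s) E.

Definition update (tau : index -> bool) (x : index) (b : bool) : index -> bool :=
  fun y => if y == x then b else tau y.

(** The conditional expectation of [h] when the coins in [s] (without repetition) are fair and all
    others are fixed by [tau]. It replaces integration by finite sums. *)
Fixpoint average (s : seq index) (h : (index -> bool) -> R) (tau : index -> bool) : R :=
  if s is x :: s' then
    (average s' h (update tau x true) + average s' h (update tau x false)) / 2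
  else h tau.

Definition indicator (E : event) (tau : index -> bool) : R := `[< E tau >]%:R.

Lemma depends_sub (S S' : {pred index}) (E : event) :
  {subset S <= S'} -> depends S E -> depends S' E.
Proof. by move=> sSS' dE tau tau' eqS'; apply: dE => x /sSS' /eqS'. Qed.

Lemma dependsI (S S' : {pred index}) (E : event) :
  depends S E -> depends S' E -> depends [predI S & S'] E.
Proof.
move=> dS dS' tau tau' eqI Etau.
(* The hybrid tape agrees with [tau] on [S] and, thanks to the agreement on the intersection, with
   [tau'] on [S'] only when the latter is read against [tau'] itself. *)
apply: (dS' (fun x => if x \in S then tau x else tau' x)) => [x Sx'|].
  by case: ifP => // Sx; apply: eqI; rewrite inE Sx.
by apply: dS Etau => x ->.
Qed.

Lemma depends_and (S : {pred index}) (E F : event) :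
  depends S E -> depends S F -> depends S (fun tau => E tau /\ F tau).
Proof. by move=> dE dF tau tau' eqS [/(dE _ _ eqS) ? /(dF _ _ eqS) ?]. Qed.

Lemma finitary_and (E F : event) :
  finitary E -> finitary F -> finitary (fun tau => E tau /\ F tau).
Proof.
move=> [s dE] [s' dF]; exists (s ++ s'); apply: depends_and.
  by apply: depends_sub dE => x; rewrite mem_cat => ->.
by apply: depends_sub dF => x; rewrite mem_cat => ->; rewrite orbT.
Qed.

Lemma measurable_cylinder (s : seq index) (b : index -> bool) :
  measurable [set w | forall x, x \in s -> coin x w = b x].
Proof.
elim: s => [|y s IH].
  by rewrite (_ : [set _ | _] = setT) //; apply/seteqP; split.
rewrite (_ : [set _ | _] =
  coin y @^-1` [set b y] `&` [set w | forall x, x \in s -> coin x w = b x]).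
  apply: measurableI => //; rewrite -[X in measurable X]setTI.
  by have [mc _] := coin_fair; exact: mc.
apply/seteqP; split=> w /= => [Hw | [Hy Hs] x].
  by split=> [|x sx]; apply: Hw; rewrite inE ?eqxx ?sx ?orbT.
by rewrite inE => /predU1P[-> //|]; apply: Hs.
Qed.

(** The coins of [s] move one by one to the list [s'] of fixed coins, the event being split by the
    value of the coin moved. When none is left, the event is either a cylinder or empty. *)
Lemma probability_cylinderI (s s' : seq index) (E : event) (b : index -> bool) :
  uniq (s ++ s') -> depends (mem (s ++ s')) E ->
  let A := [set w | (forall x, x \in s' -> coin x w = b x) /\ E (coin^~ w)] in
  measurable A /\ P A = (2^-1 ^+ size s' * average s (indicator E) b)%:E.
Proof.
elim: s s' b => [|x s IH] s' b /= us dE.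
  rewrite /indicator; case: asboolP => Eb; last first.
    rewrite mulr0 (_ : [set _ | _] = set0) ?measure0 //.
    apply/seteqP; split=> // w [/= Hw Ew]; apply: Eb.
    by apply: dE Ew => x /Hw.
  have [_ Pc] := coin_fair; rewrite mulr1 -(Pc s' b us) (_ : [set _ | _] =
    [set w | forall x, x \in s' -> coin x w = b x]).
    by split=> //; apply: measurable_cylinder.
  apply/seteqP; split=> w /= => [[]|Hw] //; split=> //.
  by apply: dE Eb => x /Hw.
case/andP: us => xs us.
have us' : uniq (s ++ x :: s').
  by rewrite -cat1s uniq_catCA /= xs us.
have dE' : depends (mem (s ++ x :: s')) E.
  by apply: depends_sub dE => y; rewrite !(inE, mem_cat) orbCA.
have [mt Pt] := IH _ (update b x true) us' dE'.
have [mf Pf] := IH _ (update b x false) us' dE'.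
set At := [set w | _] in mt Pt; set Af := [set w | _] in mf Pf.
have -> : [set w | (forall y, y \in s' -> coin y w = b y) /\ E (coin^~ w)] = At `|` Af.
  have upd c y w : y \in s' -> (coin y w = update b x c y) = (coin y w = b y).
    rewrite /update; case: eqP => // -> sx'.
    by move: xs; rewrite mem_cat sx' orbT.
  apply/seteqP; split=> w /=.
    move=> [Hw Ew]; case Ex : (coin x w); [left | right]; split=> // y;
    by rewrite inE => /predU1P[->|sy]; [rewrite /update eqxx | rewrite upd ?Hw].
  by move=> [] [Hw Ew]; split=> // y sy; have := Hw y; rewrite inE sy orbT upd //; apply.
split; first exact: measurableU.
have -> : (P (At `|` Af) = P At + P Af)%E.
  apply: measureU => //; apply/seteqP; split=> // w [[/= Hw _] [/= Hw' _]].
  by have := Hw x (mem_head _ _); rewrite (Hw' x (mem_head _ _)) /update eqxx.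
rewrite Pt Pf -EFinD; congr EFin.
by rewrite /= exprS -mulrDr [2^-1 * _]mulrC -mulrA [2^-1 * _]mulrC.
Qed.

(** All coins relevant to [E] are averaged, so the base tape [b] is arbitrary. *)
Lemma Pr_average (s : seq index) (E : event) (b : index -> bool) :
  uniq s -> depends (mem s) E -> Pr E = average s (indicator E) b.
Proof.
move=> us dE; have := @probability_cylinderI s [::] E b.
rewrite cats0 => /(_ us dE) [_]; rewrite expr0 mul1r => PA.
rewrite -[RHS]/(fine (average s (indicator E) b)%:E) -PA.
by congr (fine (P _)); apply/seteqP; split=> w /= => [|[]].
Qed.

Lemma finitary_measurable (E : event) :
  finitary E -> measurable [set w | E (coin^~ w)].
Proof.
move=> [s dE].
have dE' : depends (mem (undup s ++ [::])) E.
  by apply: depends_sub dE => x; rewrite cats0 mem_undup.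
have [|mE _] := probability_cylinderI (fun=> false) _ dE'.
  by rewrite cats0 undup_uniq.
rewrite (_ : [set _ | _] =
  [set w | (forall x, x \in [::] -> coin x w = false) /\ E (coin^~ w)]) //.
by apply/seteqP; split=> w /= => [|[]].
Qed.

Lemma Pr_fin (E : event) : finitary E -> P [set w | E (coin^~ w)] = (Pr E)%:E.
Proof. by move=> /finitary_measurable mE; rewrite fineK // fin_num_measure. Qed.

Lemma le_Pr (E F : event) : finitary E -> finitary F ->
  (forall tau, E tau -> F tau) -> Pr E <= Pr F.
Proof.
move=> fE fF sEF; rewrite -lee_fin -!Pr_fin //.
by apply: le_measure; rewrite ?inE; try exact: finitary_measurable; move=> w; apply: sEF.
Qed.

Lemma Pr_le1 (E : event) : finitary E -> Pr E <= 1.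
Proof.
move=> fE; rewrite -lee_fin -Pr_fin //.
by apply: probability_le1; apply: finitary_measurable.
Qed.

Lemma Pr_ge0 (E : event) : 0 <= Pr E.
Proof. exact: fine_ge0. Qed.

Lemma Pr_not (E : event) : finitary E ->
  P [set w | ~ E (coin^~ w)] = (1 - Pr E)%:E.
Proof.
move=> fE; rewrite -[X in P X]/(~` [set w | E (coin^~ w)]).
by rewrite probability_setC ?Pr_fin //; apply: finitary_measurable.
Qed.

(** A union bound: [E] is covered by [E /\ F] and the complement of [F]. *)
Lemma Pr_and_ge (E F : event) : finitary E -> finitary F ->
  Pr E + Pr F - 1 <= Pr (fun tau => E tau /\ F tau).
Proof.
move=> fE fF; have fEF := finitary_and fE fF.
suff : (Pr E <= Pr (fun tau => E tau /\ F tau) + (1 - Pr F)) by lra.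
rewrite -lee_fin EFinD -Pr_not // -!Pr_fin //.
have mF := finitary_measurable fF; have mEF := finitary_measurable fEF.
have mnF : measurable [set w | ~ F (coin^~ w)] by exact: measurableC.
apply: le_trans (measureU2 _ _ _) => //.
apply: le_measure; rewrite ?inE; [exact: finitary_measurable | exact: measurableU |].
by move=> w /= Ew; have [Fw|Fw] := pselect (F (coin^~ w)); [left | right].
Qed.

Lemma average_cat (s s' : seq index) (h : (index -> bool) -> R) tau :
  average (s ++ s') h tau = average s (average s' h) tau.
Proof. by elim: s tau => //= x s IH tau; rewrite !IH. Qed.

Lemma eq_average (s : seq index) (h h' : (index -> bool) -> R) tau :
  h =1 h' -> average s h tau = average s h' tau.
Proof. by move=> eqh; elim: s tau => //= x s IH tau; rewrite !IH. Qed.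

Lemma averageMr (s : seq index) (h : (index -> bool) -> R) (a : R) tau :
  average s (fun tau' => h tau' * a) tau = average s h tau * a.
Proof. by elim: s tau => //= x s IH tau; rewrite !IH -mulrDl mulrAC. Qed.

Lemma average_indicatorM (S : {pred index}) (E : event) (s : seq index)
    (h : (index -> bool) -> R) tau :
  depends S E -> {in s, forall x, x \notin S} ->
  average s (fun tau' => indicator E tau' * h tau') tau =
  indicator E tau * average s h tau.
Proof.
move=> dE; elim: s tau => //= x s IH tau sS.
rewrite !IH; try by move=> y sy; apply: sS; rewrite inE sy orbT.
have upd c : indicator E (update tau x c) = indicator E tau.
  congr (nat_of_bool _)%:R; apply/asbool_equiv_eq.
  have Sx : x \notin S by apply: sS; rewrite inE eqxx.
  by split; apply: dE => y; rewrite /update; case: eqP => // ->; rewrite (negbTE Sx).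
by rewrite !upd -mulrDr mulrA.
Qed.

(** A finite Fubini argument: the relevant coins of [E] and [F] can be cut down to disjoint lists
    inside and outside [S]. The inner average over the second list leaves the indicator of [E] times
    the constant [Pr F]. *)
Lemma Pr_indep (S : {pred index}) (E F : event) :
  finitary E -> finitary F -> depends S E -> depends [predC S] F ->
  Pr (fun tau => E tau /\ F tau) = Pr E * Pr F.
Proof.
move=> [s dE] [s' dF] SE SF.
pose s1 := [seq x <- undup s | x \in S]; pose s2 := [seq x <- undup s' | x \notin S].
have dE1 : depends (mem s1) E.
  apply: depends_sub (dependsI dE SE) => x.
  by rewrite inE mem_filter mem_undup andbC.
have dF2 : depends (mem s2) F.
  apply: depends_sub (dependsI dF SF) => x.
  by rewrite inE mem_filter mem_undup andbC.
have u1 : uniq s1 by rewrite filter_uniq ?undup_uniq.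
have u2 : uniq s2 by rewrite filter_uniq ?undup_uniq.
have u12 : uniq (s1 ++ s2).
  rewrite cat_uniq u1 u2 andbT; apply/hasPn => x.
  by rewrite !mem_filter => /andP[/negbTE ->].
have b : index -> bool by exact: (fun=> false).
have dEF : depends (mem (s1 ++ s2)) (fun tau => E tau /\ F tau).
  apply: depends_and; [apply: depends_sub dE1 | apply: depends_sub dF2] => x;
  by rewrite mem_cat => ->; rewrite ?orbT.
rewrite (Pr_average b u12 dEF) average_cat (Pr_average b u1 dE1) -averageMr.
apply: eq_average => tau; rewrite (Pr_average tau u2 dF2) -(average_indicatorM _ _ SE).
  by apply: eq_average => tau'; rewrite /indicator asbool_and -natrM mulnb.
by move=> x; rewrite mem_filter => /andP[].
Qed.

Lemma average_reindex (sigma : index -> index) (s : seq index)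
    (h : (index -> bool) -> R) tau :
  injective sigma ->
  average (map sigma s) (fun tau' => h (tau' \o sigma)) tau = average s h (tau \o sigma).
Proof.
move=> inj; elim: s tau => //= x s IH tau; rewrite !IH.
suff upd c : update tau (sigma x) c \o sigma = update (tau \o sigma) x c by rewrite !upd.
by apply/funext => y; rewrite /update /= (inj_eq inj).
Qed.

Lemma Pr_reindex (sigma : index -> index) (E : event) :
  injective sigma -> finitary E -> Pr (fun tau => E (tau \o sigma)) = Pr E.
Proof.
move=> inj [s dE].
have dE' : depends (mem (undup s)) E.
  by apply: depends_sub dE => x; rewrite mem_undup.
have us := undup_uniq s.
have b : index -> bool by exact: (fun=> false).
rewrite (Pr_average (b \o sigma) us dE') -average_reindex //.
apply: Pr_average; first by rewrite map_inj_uniq.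
by move=> tau tau' eqt; apply: dE' => x sx; apply: eqt; rewrite map_f.
Qed.

End Coins.

(** * Paths, and executions on their prefixes and suffixes *)

Section Paths.
Variable Sigma : Type.

Section PathInstance.
Variables (n : nat) (f : nat -> Sigma).

Let adjacent : rel 'I_n.+1 := fun u v => (u.+1 == v :> nat) || (v.+1 == u :> nat).

Lemma adjacent_sym : symmetric adjacent.
Proof. by move=> u v; rewrite /adjacent orbC. Qed.

Lemma adjacent_irr : irreflexive adjacent.
Proof. by move=> u; rewrite /adjacent; lia. Qed.

Lemma adjacent_connected u v : connect adjacent u v.
Proof.
have from0 w : connect adjacent ord0 w.
  case: w => i; elim: i => [|i IH] lti.
    by rewrite (_ : Ordinal lti = ord0) ?connect0 //; apply: val_inj.
  apply: connect_trans (IH (ltnW lti)) (connect1 _).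
  by rewrite /adjacent /= eqxx.
apply: connect_trans (from0 v); rewrite (sym_connect_sym adjacent_sym).
exact: from0.
Qed.

(** Here [n] counts edges, so the path is never empty. Labels are given on all of [nat], so that
    cutting and gluing become arithmetic on indices. *)
Definition path_instance : instance Sigma :=
  Instance (fun u : 'I_n.+1 => f u) (ltn0Sn n)
    adjacent_sym adjacent_irr adjacent_connected.

Lemma path_instance_is_path : is_path path_instance.
Proof. by exists id; split=> //; exists id. Qed.

End PathInstance.

Definition path_exec (A : algorithm Sigma) n f (g : nat -> int)
    (tau : nat * nat * nat -> bool) t (v : 'I_n.+1) : state A :=
  @exec Sigma A (path_instance n f) (fun v : 'I_n.+1 => g v)
    (fun (v : 'I_n.+1) r k => tau (v : nat, r, k)) t v.

Lemma inj_ids n (g : nat -> int) : injective g -> injective (fun v : 'I_n.+1 => g v).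
Proof. by move=> inj u v /inj /val_inj. Qed.

(** In [t] rounds node [u] sees no position beyond [u + t]. The condition on [i <= n] and [i <= n']
    makes an end of the path visible in both instances or in neither. *)
Lemma path_exec_prefix (A : algorithm Sigma) n n' f f' g g' tau tau' c :
  injective g -> injective g' ->
  (forall i, (i < c)%N -> [/\ (i <= n)%N = (i <= n')%N, f i = f' i, g i = g' i
                           & forall r k, tau (i, r, k) = tau' (i, r, k)]) ->
  forall t (u : 'I_n.+1) (v : 'I_n'.+1), u = v :> nat -> (u + t < c)%N ->
  path_exec A f g tau t u = path_exec A f' g' tau' t v.
Proof.
move=> injg injg' agree t u v uv utc.
pose M t (u : 'I_n.+1) (v : 'I_n'.+1) := u = v :> nat /\ (u + t < c)%N.
apply: (@exec_bisim _ A (path_instance n f) (path_instance n' f') _ _ _ _ M); last by [].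
- exact: inj_ids.
- exact: inj_ids.
- rewrite /= => {utc uv} {}t {}u {}v [uv utc]; have ltuc : (u < c)%N by lia.
  by have [_ ? ? ?] := agree _ ltuc; rewrite -uv; split.
- by rewrite /= => {uv utc} {}t {}u {}v [uv ?]; split=> //; lia.
- rewrite /= => {utc uv} {}t {}u {}v u' [uv utc] /= uu'.
  have ltuc : (u' < c)%N by lia.
  have [len _ _ _] := agree _ ltuc.
  have ltu' : (u' < n'.+1)%N by rewrite ltnS -len -ltnS.
  by exists (Ordinal ltu') => /=; [rewrite -uv | split=> //=; lia].
- rewrite /= => {utc uv} {}t {}u {}v v' [uv utc] /= vv'.
  have ltvc : (v' < c)%N by lia.
  have [len _ _ _] := agree _ ltvc.
  have ltv' : (v' < n.+1)%N by rewrite ltnS len -ltnS.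
  by exists (Ordinal ltv') => /=; [rewrite uv | split=> //=; lia].
Qed.

Definition shift (c : nat) (x : nat * nat * nat) : nat * nat * nat :=
  (c + x.1.1, x.1.2, x.2)%N.

Lemma shift_inj c : injective (shift c).
Proof. by move=> [[i r] k] [[i' r'] k'] [/addnI -> -> ->]. Qed.

(** The first node left by the cut may have lost a neighbour, but a node at distance at least [t]
    from it cannot notice: with no round to go, only a node's own data matter. *)
Lemma path_exec_suffix (A : algorithm Sigma) n f g tau c :
  injective g -> (c <= n)%N ->
  forall t (u : 'I_n.+1) (v : 'I_(n - c).+1), u = c + v :> nat -> (t <= v)%N ->
  path_exec A f g tau t u =
  path_exec A (fun i => f (c + i)%N) (fun i => g (c + i)%N) (tau \o shift c) t v.
Proof.
move=> injg cn t u v uv tv.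
pose M t (u : 'I_n.+1) (v : 'I_(n - c).+1) := u = c + v :> nat /\ (t <= v)%N.
apply: (@exec_bisim _ A (path_instance n f)
  (path_instance (n - c) (fun i => f (c + i)%N)) _ _ _ _ M); last by [].
- exact: inj_ids.
- by apply: (@inj_ids _ (fun i => g (c + i)%N)) => i j /injg /addnI.
- by rewrite /= => {uv tv} {}t {}u {}v [uv tv]; split; rewrite ?uv.
- by rewrite /= => {uv tv} {}t {}u {}v [? ?]; split=> //; lia.
- rewrite /= => {uv tv} {}t {}u {}v u' [uv tv] /= uu'.
  have ltu' : (u' - c < (n - c).+1)%N by have := ltn_ord u'; lia.
  by exists (Ordinal ltu') => /=; [lia | split=> /=; lia].
- rewrite /= => {uv tv} {}t {}u {}v v' [uv tv] /= vv'.
  have ltv' : (c + v' < n.+1)%N by have := ltn_ord v'; lia.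
  by exists (Ordinal ltv') => /=; [lia | split=> /=; lia].
Qed.

Definition all_yes (A : algorithm Sigma) T n f g lo hi tau : Prop :=
  forall v : 'I_n.+1, (lo <= v < hi)%N -> verdict (path_exec A f g tau T v) = Some true.

Lemma all_yes_prefix (A : algorithm Sigma) T n n' f f' g g' lo hi tau tau' c :
  injective g -> injective g' -> (hi + T <= c)%N ->
  (forall i, (i < c)%N -> [/\ (i <= n)%N = (i <= n')%N, f i = f' i, g i = g' i
                           & forall r k, tau (i, r, k) = tau' (i, r, k)]) ->
  all_yes A T n f g lo hi tau -> all_yes A T n' f' g' lo hi tau'.
Proof.
move=> injg injg' hic agree yes v hv.
have ltvc : (v < c)%N by lia.
have [len _ _ _] := agree _ ltvc.
have ltv : (v < n.+1)%N by rewrite ltnS len -ltnS.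
rewrite -(path_exec_prefix A injg injg' agree (u := Ordinal ltv)) //=; last by lia.
exact: yes.
Qed.

Lemma all_yes_suffix (A : algorithm Sigma) T n f g lo hi tau c :
  injective g -> (c <= n)%N -> (c + T <= lo)%N ->
  all_yes A T n f g lo hi tau <->
  all_yes A T (n - c) (fun i => f (c + i)%N) (fun i => g (c + i)%N)
    (lo - c) (hi - c) (tau \o shift c).
Proof.
move=> injg cn clo; split=> yes v hv.
  have ltv : (c + v < n.+1)%N by have := ltn_ord v; lia.
  rewrite -(path_exec_suffix A f tau injg cn (u := Ordinal ltv)) //=; last by lia.
  by apply: yes => /=; lia.
have ltv : (v - c < (n - c).+1)%N by have := ltn_ord v; lia.
rewrite (path_exec_suffix A f tau injg cn (v := Ordinal ltv)) //=; [|lia..].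
by apply: yes => /=; lia.
Qed.

Lemma all_yes_depends_lt (A : algorithm Sigma) T n f g lo hi c :
  injective g -> (hi + T <= c)%N ->
  depends [pred x | x.1.1 < c]%N (all_yes A T n f g lo hi).
Proof.
move=> injg hic tau tau' eqt; apply: (all_yes_prefix injg injg hic) => i ltic.
by split=> // r k; apply: eqt.
Qed.

Lemma all_yes_depends_ge (A : algorithm Sigma) T n f g lo hi c :
  injective g -> (c <= n)%N -> (c + T <= lo)%N ->
  depends [pred x | c <= x.1.1]%N (all_yes A T n f g lo hi).
Proof.
move=> injg cn clo tau tau' eqt.
move=> /(all_yes_suffix _ _ _ _ injg cn clo) yes.
apply/(all_yes_suffix _ _ _ _ injg cn clo).
suff <- : tau \o shift c = tau' \o shift c by [].
by apply/funext => x; apply: eqt; rewrite inE /= leq_addr.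
Qed.

Lemma all_yes_finitary (A : algorithm Sigma) T n f g lo hi :
  finitary (all_yes A T n f g lo hi).
Proof.
have [K HK] := @exec_finite _ A (path_instance n f) (fun v : 'I_n.+1 => g v) T.
exists [seq (x, k) | x <- [seq (v, r) | v <- iota 0 n.+1, r <- iota 0 T.+1],
             k <- iota 0 K].
move=> tau tau' eqt yes v hv; rewrite -(yes v hv) /path_exec.
congr (verdict (_ v)); apply: HK => {hv}v r k ler ltk; apply/esym/eqt.
apply/allpairsP; exists ((v : nat, r), k); split=> //; last by rewrite mem_iota.
apply/allpairsP; exists (v : nat, r); split=> //; rewrite mem_iota //.
by rewrite /= add0n ltn_ord.
Qed.

End Paths.

(** * Gluing two members of the language *)

Section Gluing.
Variables (R : realType) (d : measure_display) (Omega : measurableType d).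
Variables (P : probability Omega R) (coin : nat * nat * nat -> Omega -> bool).
Hypothesis coin_fair : fair_coins P coin.
Variables (Sigma : Type) (L : instance Sigma -> Prop).
Variables (A : algorithm Sigma) (T : nat) (p q : R).
Hypothesis timeT : time_at_most (@is_path Sigma) A T.
Hypothesis decider : randomized_decider P coin p q (@is_path Sigma) L A.

Local Notation Pr := (Pr P coin).
Local Notation all_yes := (all_yes A T).

Lemma Pr_all_yes_ge n f (g : nat -> int) :
  injective g -> L (path_instance n f) -> p <= Pr (all_yes n f g 0 n.+1).
Proof.
move=> injg LI; have injid := inj_ids (n := n) injg.
have [/(_ LI) + _] := decider (path_instance_is_path n f) injid.
rewrite -lee_fin -(Pr_fin coin_fair); last exact: all_yes_finitary.
move=> /le_trans; apply; rewrite le_eqVlt; apply/orP; left; apply/eqP.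
congr (P _); apply/seteqP; split=> w /= yes v.
  by move=> _; apply/(outputsE _ _ _ timeT (path_instance_is_path n f) injid)/yes.
apply/(outputsE _ _ _ timeT (path_instance_is_path n f) injid)/yes.
by rewrite /= ltn_ord.
Qed.

Lemma Pr_all_yes_le n f (g : nat -> int) :
  injective g -> ~ L (path_instance n f) -> Pr (all_yes n f g 0 n.+1) <= 1 - q.
Proof.
move=> injg LI; have injid := inj_ids (n := n) injg.
have [_ /(_ LI)] := decider (path_instance_is_path n f) injid.
suff -> : [set w | exists v, @outputs _ A (path_instance n f)
      (fun v : 'I_n.+1 => g v)
      (fun (v : 'I_n.+1) r k => coin (v : nat, r, k) w) v false] =
    [set w | ~ all_yes n f g 0 n.+1 (coin^~ w)].
  rewrite Pr_not //; last exact: all_yes_finitary.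
  by rewrite lee_fin; lra.
apply/seteqP; split=> w /=.
  move=> [v /(outputsE _ _ _ timeT (path_instance_is_path n f) injid) no] yes.
  by have := yes v; rewrite /= ltn_ord /path_exec no => /(_ isT).
move=> /existsNP[v] /not_implyP[_ noyes]; exists v.
apply/(outputsE _ _ _ timeT (path_instance_is_path n f) injid).
(* The time bound excludes a node that is still running, so a verdict other than yes is no. *)
have := @timeT (path_instance n f) (fun v : 'I_n.+1 => g v)
  (fun (v : 'I_n.+1) r k => coin (v : nat, r, k) w) v (path_instance_is_path n f) injid.
by move: noyes; rewrite /path_exec; case: verdict => [[]|].
Qed.

Lemma Pr_all_yes_suffix n f (g : nat -> int) lo hi c :
  injective g -> (c <= n)%N -> (c + T <= lo)%N ->
  Pr (all_yes n f g lo hi) =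
  Pr (all_yes (n - c) (fun i => f (c + i)%N) (fun i => g (c + i)%N) (lo - c) (hi - c)).
Proof.
move=> injg cn clo.
rewrite -[RHS](Pr_reindex coin_fair (@shift_inj c)); last exact: all_yes_finitary.
by congr (Pr _); apply/funext => tau; apply/propext; apply: all_yes_suffix.
Qed.

(* Distinct blocks of [4T] nodes have independent inner halves, so if none of
   them were likely to accept, the whole path would not be either. *)
Lemma secure_segment n f (g : nat -> int) a N (e : R) :
  injective g -> L (path_instance n f) -> (a + 4 * T * N <= n)%N ->
  e ^+ N < p -> 0 <= e ->
  exists2 b, (a + T <= b /\ b + 3 * T <= a + 4 * T * N)%N
           & e <= Pr (all_yes n f g b (b + 2 * T)).
Proof.
move=> injg LI aN eNp e0; apply: contrapT => none.
(* A margin of [T] on both sides keeps all coins seen by block [j] within its own [4 * T]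
   positions. *)
pose start j := (a + 4 * T * j + T)%N.
pose block j := all_yes n f g (start j) (start j + 2 * T).
pose blocks m tau := forall j, (j < m)%N -> block j tau.
have fin_block j : finitary (block j) by exact: all_yes_finitary.
have blocksS m : blocks m.+1 = fun tau => blocks m tau /\ block m tau.
  apply/funext => tau; apply/propext; split=> [H | [H Hm] j].
    by split=> [j /ltnW|]; apply: H.
  by rewrite ltnS leq_eqVlt => /predU1P[-> //|]; apply: H.
have fin_blocks m : finitary (blocks m).
  elim: m => [|m IH]; first by exists [::] => tau tau' _ _.
  by rewrite blocksS; apply: finitary_and.
have dep_blocks m : depends [pred x | x.1.1 < a + 4 * T * m]%N (blocks m).
  move=> tau tau' eqt H j ltjm.
  have dep : depends [pred x | x.1.1 < a + 4 * T * m]%N (block j).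
    by apply: all_yes_depends_lt => //; rewrite /start; nia.
  exact: dep eqt (H j ltjm).
have Pr_blocks m : (m <= N)%N -> Pr (blocks m) <= e ^+ m.
  elim: m => [|m IH] ltmN; first by rewrite expr0; apply: Pr_le1.
  rewrite blocksS (Pr_indep coin_fair _ _ (dep_blocks m)) //; last first.
    apply: (@depends_sub [pred x | a + 4 * T * m <= x.1.1]%N) => [x|].
      by rewrite !inE -leqNgt.
    by apply: all_yes_depends_ge => //; rewrite /start; nia.
  rewrite exprSr ler_pM ?Pr_ge0 ?IH //; first exact: ltnW.
  rewrite leNgt; apply/negP => /ltW ge; apply: none; exists (start m) => //.
  by rewrite /start; nia.
have := Pr_all_yes_ge injg LI; apply/negP; rewrite -ltNge.
apply: le_lt_trans eNp; apply: le_trans (Pr_blocks N (leqnn N)).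
apply: le_Pr => // [|tau yes j ltjN v /andP[_ hv]]; first exact: all_yes_finitary.
by apply: yes; rewrite /= ltn_ord.
Qed.

(* On a segment of the overlap that accepts with probability at least [e], both
   paths are cut and their outer parts joined.  These accept independently, each
   with probability [p], so the result accepts with probability at least
   [p ^+ 2 + e - 1 > 1 - q].  The second path carries the identities
   [j + a - a'], which agree with those of the first one on the overlap. *)
Lemma glue_paths n1 f1 n2 f2 a a' N (e : R) :
  0 <= e -> e ^+ N < p -> 0 <= p -> 2 - p ^+ 2 - q < e ->
  L (path_instance n1 f1) -> L (path_instance n2 f2) ->
  (a + 4 * T * N <= n1)%N -> (a' + 4 * T * N <= n2)%N ->
  (forall i, (i <= 4 * T * N)%N -> f1 (a + i)%N = f2 (a' + i)%N) ->
  L (path_instance (a + (n2 - a'))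
      (fun i => if (i <= a + 4 * T * N)%N then f1 i else f2 (a' + (i - a))%N)).
Proof.
move=> e0 eNp p0 eq L1 L2 aN1 aN2 agree.
set W := (4 * T * N)%N in aN1 aN2 agree *; set n := (a + (n2 - a'))%N.
set f := fun i => _.
have injP : injective Posz by move=> i j [].
have [b [ab bW] Sge] := secure_segment injP L1 aN1 eNp e0.
apply: contrapT => /(Pr_all_yes_le injP); apply/negP; rewrite -ltNge.
have prefix lo hi : (hi + T <= a + W)%N ->
    Pr (all_yes n f Posz lo hi) = Pr (all_yes n1 f1 Posz lo hi).
  move=> hiW; congr (Pr _); apply/funext => tau; apply/propext.
  have agr i : (i < (a + W).+1)%N -> (i <= n)%N = (i <= n1)%N /\ f i = f1 i.
    by rewrite ltnS /f => iW; rewrite iW; split=> //; lia.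
  by split; apply: (all_yes_prefix injP injP (leqW hiW)) => i /agr[].
pose g2 j : int := (j + a)%N%:Z - a'%:Z.
have inj2 : injective g2 by move=> i j; rewrite /g2; lia.
(* The cut is in the middle of the segment of [2 * T] nodes, so the nodes before [b] see only coins
   before [c] and those from [c + T] on only coins from [c] on. The same cut in the second path is
   [c']. *)
pose c := (b + T)%N; pose c' := (a' + (c - a))%N.
(* Removing the first [c] and [c'] nodes respectively leaves the same inputs and identities on both
   sides. *)
have right : Pr (all_yes n f Posz (c + T) n.+1) = Pr (all_yes n2 f2 g2 (c' + T) n2.+1).
  rewrite (@Pr_all_yes_suffix _ _ _ _ _ c) //; last by rewrite /n /c; lia.
  rewrite (@Pr_all_yes_suffix n2 _ _ _ _ c') //; last by rewrite /c' /c; lia.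
  have -> : (n - c)%N = (n2 - c')%N by rewrite /n /c' /c; lia.
  have -> : (n.+1 - c)%N = (n2.+1 - c')%N by rewrite /n /c' /c; lia.
  have -> : (fun i => f (c + i)%N) = (fun i => f2 (c' + i)%N).
    apply/funext => i; rewrite /f /c'; case: ifP => [ciW | _]; last first.
      by congr f2; rewrite /c; lia.
    have -> : (c + i = a + (c - a + i))%N by rewrite /c; lia.
    by rewrite agree -?addnA //; rewrite /c in ciW *; lia.
  have -> : (fun i => Posz (c + i)) = (fun i => g2 (c' + i)%N).
    by apply/funext => i; rewrite /g2 /c' /c; lia.
  by rewrite !addKn.
have leftp : p <= Pr (all_yes n f Posz 0 b).
  rewrite prefix; last by lia.
  apply: le_trans (Pr_all_yes_ge injP L1) _.
  apply: (le_Pr coin_fair); [exact: all_yes_finitary.. |].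
  by move=> tau yes v hv; apply: yes; rewrite /= ltn_ord.
have rightp : p <= Pr (all_yes n f Posz (c + T) n.+1).
  rewrite right; apply: le_trans (Pr_all_yes_ge inj2 L2) _.
  apply: (le_Pr coin_fair); [exact: all_yes_finitary.. |].
  by move=> tau yes v hv; apply: yes; rewrite /= ltn_ord.
rewrite -prefix in Sge; last by lia.
pose sides tau := all_yes n f Posz 0 b tau /\ all_yes n f Posz (c + T) n.+1 tau.
have fin_sides : finitary sides by apply: finitary_and; apply: all_yes_finitary.
have sides_ge : p ^+ 2 <= Pr sides.
  rewrite (Pr_indep coin_fair (S := [pred x | x.1.1 < c]%N)).
  - by rewrite expr2 ler_pM.
  - exact: all_yes_finitary.
  - exact: all_yes_finitary.
  - exact: all_yes_depends_lt.
  apply: (@depends_sub [pred x | c <= x.1.1]%N) => [x|].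
    by rewrite !inE -leqNgt.
  by apply: all_yes_depends_ge => //; rewrite /n /c; lia.
have fin_seg : finitary (all_yes n f Posz b (b + 2 * T)) by exact: all_yes_finitary.
have := Pr_and_ge coin_fair fin_sides fin_seg.
suff : Pr (fun tau => sides tau /\ all_yes n f Posz b (b + 2 * T) tau) <=
    Pr (all_yes n f Posz 0 n.+1) by lra.
apply: (le_Pr coin_fair); [exact: finitary_and | exact: all_yes_finitary |].
move=> tau [[yl yr] ys] v _; have ltv := ltn_ord v.
have [vb|bv] := ltnP v b; first exact: yl.
have [vc|cv] := ltnP v (c + T); first by apply: ys; rewrite bv /=; rewrite /c in vc; lia.
by apply: yr; rewrite cv.
Qed.

End Gluing.

(** * Normal forms of path instances *)

Section PathIsomorphisms.
Variable Sigma : Type.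

Lemma eq_path_instance n (f f' : nat -> Sigma) :
  (forall i, (i <= n)%N -> f i = f' i) ->
  isomorphic (path_instance n f) (path_instance n f').
Proof.
move=> eqf; exists id; split=> //; first by exists id.
by move=> u; rewrite /= eqf // -ltnS.
Qed.

Lemma rev_path_instance n (f : nat -> Sigma) :
  isomorphic (path_instance n f) (path_instance n (fun i => f (n - i)%N)).
Proof.
exists (@rev_ord n.+1); split.
- by exists (@rev_ord n.+1); apply: rev_ordK.
- by rewrite /= => u v; have := ltn_ord u; have := ltn_ord v; lia.
- by rewrite /= => u; congr f; have := ltn_ord u; lia.
Qed.

(** The nodes of a path may be numbered in any order; [pos] sends each to its position. Past [n],
    [inord] falls back to position 0, so [g] is injective on nodes only. *)
Lemma is_pathP (I : instance Sigma) (id : 'I_(nnodes I) -> int) :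
  is_path I -> exists n f (g : nat -> int) (pos : 'I_(nnodes I) -> 'I_n.+1),
    [/\ bijective pos,
        forall u v, edge (i := path_instance n f) (pos u) (pos v) = edge u v,
        forall u, f (pos u) = input u & forall u, g (pos u) = id u].
Proof.
case: I id => -[|n] //= e inp n0 esym eirr econn id [h [[pos hK posK] he]].
rewrite /= in h he pos hK posK *.
exists n, (inp \o h \o inord), (id \o h \o inord), pos; split=> [|u v|u|u] /=.
- by exists h.
- by rewrite -he !posK.
- by rewrite inord_val posK.
- by rewrite inord_val posK.
Qed.

End PathIsomorphisms.

(** * The deterministic algorithm that checks views *)

Section LocalDecider.
Variables (Sigma : finType) (L : instance Sigma -> Prop) (r : nat).

(** Inputs are listed outwards from node [k]; a length below [t] betrays the end of the path. *)
Definition left_arm t (f : nat -> Sigma) k : seq Sigma :=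
  mkseq (fun i => f (k - i.+1)%N) (minn t k).

Definition right_arm t n (f : nat -> Sigma) k : seq Sigma :=
  mkseq (fun i => f (k + i.+1)%N) (minn t (n - k)).

(** Two pairs containing the support of [m] yield the same values up to a swap, since an identity
    outside either pair gets [None]. This makes the choice of identities in [occurs_in_L]
    harmless. *)
Lemma pair_supportP (T : Type) (m : int -> option T) i j i' j' :
  i <> j -> i' <> j' ->
  (forall e, m e <> None -> e = i \/ e = j) ->
  (forall e, m e <> None -> e = i' \/ e = j') ->
  (m i' = m i /\ m j' = m j) \/ (m i' = m j /\ m j' = m i).
Proof.
move=> ij ij' supp supp'.
have none a b e : (forall e, m e <> None -> e = a \/ e = b) ->
    e <> a -> e <> b -> m e = None.
  by move=> sup ea eb; apply: contrapT => /sup[].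
have nij := none _ _ _ supp; have nij' := none _ _ _ supp'.
case: (pselect (i' = i)) => [?|i'i]; [subst i'|].
  left; split=> //; case: (pselect (j' = j)) => [-> //|j'j].
  by rewrite (nij j') ?(nij' j) //; congruence.
case: (pselect (i' = j)) => [?|i'j]; [subst i'|].
  right; split=> //; case: (pselect (j' = i)) => [-> //|j'i].
  by rewrite (nij j') ?(nij' i) //; congruence.
rewrite (nij i') //; case: (pselect (j' = i)) => [e|j'i].
  by right; rewrite e (nij' j) //; congruence.
case: (pselect (j' = j)) => [e|j'j].
  by left; rewrite e (nij' i) //; congruence.
by left; rewrite (nij j') // (nij' i) ?(nij' j) //; congruence.
Qed.

Lemma mkseq_cons (f : nat -> Sigma) k :
  mkseq f k.+1 = f 0%N :: mkseq (fun i => f i.+1) k.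
Proof. by rewrite /mkseq /= (iotaDl 1 0) -map_comp. Qed.

Lemma left_armS t f k : left_arm t.+1 f k.+1 = f k :: left_arm t f k.
Proof. by rewrite /left_arm minnSS mkseq_cons subn1. Qed.

Lemma right_armS t n f k :
  (k < n)%N -> right_arm t.+1 n f k = f k.+1 :: right_arm t n f k.+1.
Proof.
move=> ltkn; rewrite /right_arm -(subnSK ltkn) minnSS mkseq_cons addn1.
by congr (_ :: _); apply: eq_mkseq => i; rewrite addSnnS.
Qed.

(* The two arms come without orientation, the identities [i] and [j] standing
   for a missing neighbour at an end of the path. *)
Definition occurs_in_L (a : Sigma) (arm : int -> option (seq Sigma)) : Prop :=
  exists n f k i j,
    [/\ [/\ L (path_instance n f), (k <= n)%N & f k = a], i <> j,
        odflt [::] (arm i) = left_arm r f k,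
        odflt [::] (arm j) = right_arm r n f k
      & forall e, arm e <> None -> e = i \/ e = j].

(* The state is the round, the input, and for each identity of a neighbour the
   inputs met when walking away through this neighbour. *)
Definition local_decider : algorithm Sigma :=
  @Algorithm Sigma (nat * Sigma * (int -> option (seq Sigma))) (seq Sigma)
    (fun _ a => Ret (0%N, a, fun=> None))
    (fun s i => s.1.2 :: xget [::] [set w | exists j, j <> i /\ s.2 j = Some w])
    (fun s m => Ret (s.1.1.+1, s.1.2, m))
    (fun s => if (s.1.1 < r)%N then None else Some `[< occurs_in_L s.1.2 s.2 >]).

Lemma local_decider_deterministic : deterministic local_decider.
Proof. by split=> *; eexists. Qed.

Lemma local_decider_step (I : instance Sigma) id toss t (v : 'I_(nnodes I)) :
  ((exec local_decider id toss t v).1.1 < r)%N ->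
  exec local_decider id toss t.+1 v =
  ((exec local_decider id toss t v).1.1.+1, (exec local_decider id toss t v).1.2,
   inbox id (exec local_decider id toss t) v).
Proof. by move=> /= ->. Qed.

Section OnPath.
Variables (n : nat) (f : nat -> Sigma) (g : nat -> int).
Hypothesis injg : injective (fun v : 'I_n.+1 => g v).

(** What node [v] should know through identity [i] after [t] rounds; nothing at all before the first
    round. *)
Definition arm t (v : nat) (i : int) : option (seq Sigma) :=
  if t == 0%N then None
  else if (0 < v)%N && (i == g v.-1) then Some (left_arm t f v)
  else if (v < n)%N && (i == g v.+1) then Some (right_arm t n f v)
  else None.

Lemma eq_id i j : (i <= n)%N -> (j <= n)%N -> (g i == g j) = (i == j).
Proof.
move=> ltin ltjn; apply/eqP/eqP => [|-> //].
by move/(injg (x1 := Ordinal (ltin : i < n.+1)%N)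
  (x2 := Ordinal (ltjn : j < n.+1)%N))/(congr1 val).
Qed.

Lemma arm_left t v : (0 < v)%N -> arm t.+1 v (g v.-1) = Some (left_arm t.+1 f v).
Proof. by move=> v0; rewrite /arm v0 eqxx. Qed.

Lemma arm_right t v : (v < n)%N -> arm t.+1 v (g v.+1) = Some (right_arm t.+1 n f v).
Proof.
move=> vn; rewrite /arm vn eqxx /= eq_id //; last by lia.
by case: ifP => //; lia.
Qed.

Lemma armP t v i w : (v <= n)%N -> arm t v i = Some w ->
  [/\ (0 < v)%N, i = g v.-1 & w = left_arm t f v] \/
  [/\ (v < n)%N, i = g v.+1 & w = right_arm t n f v].
Proof.
rewrite /arm => vn; case: eqP => // _.
case: ifP => [/andP[? /eqP ?] [<-]|_]; first by left.
by case: ifP => // /andP[? /eqP ?] [<-]; right.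
Qed.

(** On a path there is at most one other neighbour, so the choice made by [xget] is forced. Its
    default [[::]] is the right arm length in round 0 and at an end of the path. *)
Lemma away_left t v : (v < n)%N ->
  xget [::] [set w | exists j, j <> g v.+1 /\ arm t v j = Some w] = left_arm t f v.
Proof.
move=> vn.
have uniq w : (exists j, j <> g v.+1 /\ arm t v j = Some w) -> w = left_arm t f v.
  by move=> [j [jv /(armP (ltnW vn))[[]|[_ /jv]]]].
case: xgetP => [w _ /uniq //|none].
case: t uniq none => [|t] uniq none; first by rewrite /left_arm min0n.
have [-> | v0] := posnP v; first by rewrite /left_arm minn0.
case: (none (left_arm t.+1 f v)); exists (g v.-1); split; last exact: arm_left.
by apply/eqP; rewrite eq_id //; lia.
Qed.

Lemma away_right t v : (0 < v <= n)%N ->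
  xget [::] [set w | exists j, j <> g v.-1 /\ arm t v j = Some w] = right_arm t n f v.
Proof.
move=> /andP[v0 vn].
have uniq w : (exists j, j <> g v.-1 /\ arm t v j = Some w) -> w = right_arm t n f v.
  by move=> [j [jv /(armP vn)[[_ /jv]|[]]]].
case: xgetP => [w _ /uniq //|none].
case: t uniq none => [|t] uniq none; first by rewrite /right_arm min0n.
move: vn; rewrite leq_eqVlt => /predU1P[-> | vn].
  by rewrite /right_arm subnn minn0.
case: (none (right_arm t.+1 n f v)); exists (g v.+1); split; last exact: arm_right.
by apply/eqP; rewrite eq_id //; lia.
Qed.

Lemma exec_local_decider toss t (v : 'I_n.+1) : (t <= r)%N ->
  @exec _ local_decider (path_instance n f) (fun v : 'I_n.+1 => g v) toss t v =
  (t, f v, arm t v).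
Proof.
elim: t v => [|t IH] v ltr //.
have {}IH : @exec _ local_decider (path_instance n f) (fun v : 'I_n.+1 => g v) toss t =
    fun u : 'I_n.+1 => (t, f u, arm t u).
  by apply/funext => u; rewrite IH // ltnW.
rewrite local_decider_step IH //; congr (_, _).
apply/funext => i; rewrite /inbox; case: v => v ltv.
case: pickP => [[u ltu] /= /and3P[uv /eqP idu _] | none].
  (* The sender transmits its input followed by its arm away from the receiver, so arms grow by one
     node per round. *)
  rewrite -idu; case/orP: uv => /eqP uv; subst.
    by rewrite arm_right // right_armS // -(away_right t (v := v.+1)).
  by rewrite (arm_left t (v := u.+1)) // left_armS -(away_left t).
case E: (arm t.+1 v i) => [w|] //=.
have noid u (ltu : (u < n.+1)%N) : (v.+1 == u) || (u.+1 == v) -> i <> g u.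
  by move=> uv iu; have := none (Ordinal ltu); rewrite /= uv iu eqxx ltr.
have [[v0 iv _]|[vn iv _]] := armP ltv E; last by case: (noid v.+1) => //; rewrite eqxx.
by case: (noid v.-1) => //; [lia | rewrite prednK // eqxx orbT].
Qed.

Lemma arm_pair v : (v <= n)%N -> (0 < r)%N ->
  exists i j, [/\ i <> j, odflt [::] (arm r v i) = left_arm r f v,
    odflt [::] (arm r v j) = right_arm r n f v &
    forall e, arm r v e <> None -> e = i \/ e = j].
Proof.
case: r => // t vn _.
(* A missing neighbour gets an identity off by one from that of the other side, so that the two
   differ. *)
pose i := if (0 < v)%N then g v.-1 else g v.+1 - 1.
pose j := if (v < n)%N then g v.+1 else i + 1.
have ij : i <> j.
  rewrite /j /i; case: ifP => [v0|_]; case: ifP => [vlt|_]; try lia.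
  by apply/eqP; rewrite eq_id //; lia.
exists i, j; split=> //.
- rewrite /i; case: ltnP => [v0|]; first by rewrite arm_left.
  rewrite leqn0 => /eqP v0; rewrite v0 /left_arm minn0 /arm /=.
  by case: ifP => // /andP[_ /eqP]; lia.
- rewrite /j; case: ltnP => [vlt|vge]; first by rewrite arm_right.
  have -> : right_arm t.+1 n f v = [::].
    by rewrite /right_arm (_ : (n - v = 0)%N) ?minn0 //; lia.
  rewrite /arm /i (_ : (v < n)%N = false) /=; last by lia.
  case: ifP => //=; case: ifP => // _ /eqP.
  by lia.
- move=> e; case E: arm => [w|] // _.
  have [[v0 -> _]|[vlt -> _]] := armP vn E; rewrite /j /i ?v0 ?vlt.
    by left.
  by right.
Qed.

Lemma occurs_in_L_arm v : (v <= n)%N -> (0 < r)%N ->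
  L (path_instance n f) -> occurs_in_L (f v) (arm r v).
Proof.
by move=> vn r0 LI; have [i [j [? ? ? ?]]] := arm_pair vn r0; exists n, f, v, i, j.
Qed.

(** The two arms may match in swapped order; the member of [L] is then reversed. *)
Lemma arm_occurs_in_L v :
  (forall I J, isomorphic I J -> L I -> L J) -> (v <= n)%N -> (0 < r)%N ->
  occurs_in_L (f v) (arm r v) ->
  exists n' f' k, [/\ L (path_instance n' f'), (k <= n')%N, f' k = f v,
    left_arm r f' k = left_arm r f v & right_arm r n' f' k = right_arm r n f v].
Proof.
move=> Liso vn r0 [n' [f' [k [i' [j' [[LI kn fk] ij' li' rj' only']]]]]].
have [i [j [ij li rj only]]] := arm_pair vn r0.
have [[li'' rj'']|[li'' rj'']] : (left_arm r f' k = left_arm r f v /\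
    right_arm r n' f' k = right_arm r n f v) \/
    (left_arm r f' k = right_arm r n f v /\ right_arm r n' f' k = left_arm r f v).
- rewrite -li -rj -li' -rj'.
  by have [[-> ->]|[-> ->]] := pair_supportP ij ij' only only'; [left | right].
- by exists n', f', k.
exists n', (fun i => f' (n' - i)%N), (n' - k)%N; split.
- exact: Liso (rev_path_instance n' f') LI.
- by rewrite leq_subr.
- by rewrite subKn.
- rewrite -rj'' /left_arm /right_arm; apply/eq_in_map => d; rewrite mem_iota => dk.
  by congr f'; lia.
- rewrite -li'' /left_arm /right_arm subKn //.
  apply/eq_in_map => d; rewrite mem_iota => dk.
  by congr f'; lia.
Qed.

End OnPath.
End LocalDecider.

(** * From local views to membership *)

Section Reconstruction.
Variables (Sigma : finType) (L : instance Sigma -> Prop) (W : nat).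
Hypothesis L_iso : forall I J, isomorphic I J -> L I -> L J.
Hypothesis L_glue : forall n1 (f1 : nat -> Sigma) n2 f2 a a',
  L (path_instance n1 f1) -> L (path_instance n2 f2) ->
  (a + W <= n1)%N -> (a' + W <= n2)%N ->
  (forall i, (i <= W)%N -> f1 (a + i)%N = f2 (a' + i)%N) ->
  L (path_instance (a + (n2 - a'))
      (fun i => if (i <= a + W)%N then f1 i else f2 (a' + (i - a))%N)).

(** Equal arms have equal lengths, which compares the distances to the ends up to [t]. *)
Lemma left_arm_inj t (f f' : nat -> Sigma) k k' :
  left_arm t f' k' = left_arm t f k ->
  minn t k' = minn t k /\
  forall i, (i < minn t k)%N -> f' (k' - i.+1)%N = f (k - i.+1)%N.
Proof.
move=> eqa; have := congr1 size eqa; rewrite !size_mkseq => eqk.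
by split=> // i lti; have := congr1 (nth (f 0%N) ^~ i) eqa; rewrite !nth_mkseq ?eqk.
Qed.

Lemma right_arm_inj t n n' (f f' : nat -> Sigma) k k' :
  right_arm t n' f' k' = right_arm t n f k ->
  minn t (n' - k') = minn t (n - k) /\
  forall i, (i < minn t (n - k))%N -> f' (k' + i.+1)%N = f (k + i.+1)%N.
Proof.
move=> eqa; have := congr1 size eqa; rewrite !size_mkseq => eqk.
by split=> // i lti; have := congr1 (nth (f 0%N) ^~ i) eqa; rewrite !nth_mkseq ?eqk.
Qed.

(* Following the path from its end [0], a member of [L] sharing a prefix with it
   is glued to the one providing the view of the next node. *)
Lemma locally_in_L n (f : nat -> Sigma) :
  (forall v, (v <= n)%N -> exists n' f' k,
    [/\ L (path_instance n' f'), (k <= n')%N, f' k = f v,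
      left_arm W.+1 f' k = left_arm W.+1 f v &
      right_arm W.+1 n' f' k = right_arm W.+1 n f v]) ->
  L (path_instance n f).
Proof.
move=> views.
have [n0 [f0 [k0 [L0 k0n0 f0k0 /left_arm_inj[k00 _] /right_arm_inj[n0E f0E]]]]] :=
  views 0%N (leq0n n).
have {k00}? : k0 = 0%N by lia.
subst k0; rewrite !subn0 in n0E f0E *.
have {f0k0}f0E i : (i <= minn W.+1 n)%N -> f0 i = f i.
  by case: i => [|i] // /f0E; rewrite !add0n.
(* A path with at most [W] edges lies entirely in the view of its first node. *)
have [nW | Wn] := leqP n W.
  have ? : n0 = n by lia.
  by subst n0; apply: L_iso (eq_path_instance _) L0 => i lti; apply: f0E; lia.
have extend m : (W + m <= n)%N -> exists n1 f1,
    [/\ L (path_instance n1 f1), (W + m <= n1)%N, (W + m = n -> n1 = n)%N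
      & forall i, (i <= W + m)%N -> f1 i = f i].
  elim: m => [|m IH] mn.
    exists n0, f0; split=> //; [lia | lia |].
    by move=> i lti; apply: f0E; lia.
  have [n1 [f1 [L1 mn1 _ f1E]]] := IH ltac:(lia).
  (* The left arm of the new node has [W.+1] entries, exactly the nodes of the overlap, hence the
     radius [W.+1]. Its right arm tells whether the new node is the last one, which settles the
     final length. *)
  have [n2 [f2 [k [L2 kn2 f2k /left_arm_inj[kE f2E] /right_arm_inj[n2E _]]]]] :=
    views (W + m.+1)%N mn.
  have Wk : (W < k)%N by lia.
  have eqW i : (i <= W)%N -> f1 (m + i)%N = f2 (k - W.+1 + i)%N.
    move=> iW; rewrite f1E; last by lia.
    have := f2E (W - i)%N ltac:(lia).
    have -> : (k - (W - i).+1 = k - W.+1 + i)%N by lia.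
    by have -> : (W + m.+1 - (W - i).+1 = m + i)%N by lia.
  have := L_glue L1 L2 (a := m) (a' := (k - W.+1)%N) ltac:(lia) ltac:(lia) eqW.
  set n3 := (m + _)%N; set f3 := fun i => _ => L3.
  exists n3, f3; split=> //; [by rewrite /n3; lia | by rewrite /n3; lia |].
  move=> i lti; rewrite /f3; case: ifP => [iW|]; first by rewrite f1E //; lia.
  move=> /negbT; rewrite -ltnNge => ltWi.
  have -> : i = (W + m.+1)%N by lia.
  by rewrite -f2k; congr f2; lia.
have [n1 [f1 [L1 _ n1E f1E]]] := extend (n - W)%N ltac:(lia).
have ? : n1 = n by apply: n1E; lia.
by subst n1; apply: L_iso (eq_path_instance _) L1 => i lti; apply: f1E; lia.
Qed.

Lemma local_decider_correct :
  time_at_most (@is_path Sigma) (local_decider L W.+1) W.+1 /\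
  decides (@is_path Sigma) L (local_decider L W.+1).
Proof.
suff key (I : instance Sigma) (id : 'I_(nnodes I) -> int) toss :
    is_path I -> injective id ->
    exists2 ans : 'I_(nnodes I) -> Prop,
      forall v, verdict (exec (local_decider L W.+1) id toss W.+1 v) = Some `[< ans v >] &
      (L I <-> forall v, ans v).
  split=> I id toss => [v|] pI injid; have [ans ansE LE] := key I id toss pI injid.
    by rewrite ansE.
  split=> [/LE yes v|notL]; first by exists W.+1; rewrite ansE asboolT.
  have /existsNP[v nov] : ~ forall v, ans v by move/LE.
  by exists v, W.+1; rewrite ansE asboolF.
move=> pI injid.
have [n [f [g [pos [[pos' posK pos'K] posE fE gE]]]]] := is_pathP id pI.
have injg : injective (fun v : 'I_n.+1 => g v).
  move=> u v; rewrite -(pos'K u) -(pos'K v) !gE => /injid ->.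
  by [].
pose ans v := occurs_in_L L W.+1 (f (pos v)) (arm n f g W.+1 (pos v)).
exists ans => [v|].
  have -> : exec (local_decider L W.+1) id toss W.+1 v =
      @exec _ (local_decider L W.+1) (path_instance n f) (fun v : 'I_n.+1 => g v)
        (fun v : 'I_n.+1 => toss (pos' v)) W.+1 (pos v).
    (* An isomorphism is a bisimulation for any number of rounds. *)
    apply: (@exec_bisim _ _ I (path_instance n f) _ _ _ _ (fun _ u v => pos u = v)) => //.
    - by move=> _ u _ <-; split=> [||r k] /=; rewrite ?gE ?fE ?posK.
    - by move=> _ u _ u' <- uu'; exists (pos u') => //; rewrite posE.
    - move=> _ u _ w <- uw; exists (pos' w); last exact: pos'K.
      by rewrite -posE pos'K.
  by rewrite exec_local_decider //= ltnn.
have isoI : isomorphic (path_instance n f) I.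
  exists pos'; split; first by exists pos.
  - by move=> u v; rewrite -posE !pos'K.
  - by move=> u; rewrite -fE pos'K.
have isoI' : isomorphic I (path_instance n f).
  by exists pos; split=> //; exists pos'.
split=> [LI v | yes].
  by apply: occurs_in_L_arm => //; [rewrite -ltnS | exact: L_iso isoI' LI].
apply: (L_iso isoI); apply: locally_in_L => v vn.
have ltv : (v < n.+1)%N by [].
have := yes (pos' (Ordinal ltv)); rewrite /ans pos'K /=.
exact: arm_occurs_in_L.
Qed.

End Reconstruction.

(** * Choice of the constants and conclusion *)

Lemma expr_lt (R : realType) (e p : R) : 0 <= e < 1 -> 0 < p -> exists N, e ^+ N < p.
Proof.
move=> /andP[e0 e1] p0; have /cvg_expr ce : `|e| < 1 by rewrite ger0_norm.
have [N _ HN] := cvgr_lt 0 ce p p0.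
by exists N; apply: HN => /=.
Qed.

Theorem theorem4p1 (Sigma : finType)
    (R : realType) (d : measure_display) (Omega : measurableType d)
    (P : probability Omega R) (coin : nat * nat * nat -> Omega -> bool)
    (coin_fair : fair_coins P coin)
    (L : instance Sigma -> Prop) (L_language : language L) :
  in_B1_const P coin (@is_path Sigma) L ->
  in_LD_const (@is_path Sigma) L.
Proof.
move=> [p [q [/andP[p0 p1] /andP[q0 q1] pq [A [T [timeT decider]]]]]].
have [L_iso _] := L_language.
(* The midpoint between [2 - p ^+ 2 - q] and 1, which differ because [p ^+ 2 + q] exceeds 1. *)
pose e : R := (3 - p ^+ 2 - q) / 2.
have p2 : p ^+ 2 <= 1 by rewrite expr_le1 // ltW.
have e0 : 0 <= e by rewrite /e; lra.
have e1 : e < 1 by rewrite /e; lra.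
have [|N eNp] := @expr_lt R e p _ p0; first by rewrite e0.
have screened : 2 - p ^+ 2 - q < e by rewrite /e; lra.
(* The overlap has room for [N] blocks of [4 * T] nodes. *)
have [|timeD decD] := @local_decider_correct _ L (4 * T * N) L_iso.
  move=> n1 f1 n2 f2 a a'.
  exact: (glue_paths coin_fair timeT decider e0 eNp (ltW p0) screened).
exists (local_decider L (4 * T * N).+1), (4 * T * N).+1; split=> //.
exact: local_decider_deterministic.
Qed.
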